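(* Let $Z\subset\mathbb{R}^n$ be an $n$-dimensional lattice parallelepiped. Then $\mathrm{g}_i(Z)\leq \sigma_i(Z)$ for all $i=0,\dots,n$.
   Context: A lattice parallelepiped is a set $p+\sum_{i=1}^n[0,v_i]$ with $p,v_1,\dots,v_n\in\mathbb{Z}^n$. For an $n$-dimensional lattice polytope $P$ (vertices in $\mathbb{Z}^n$), $\#(kP\cap\mathbb{Z}^n)=\sum_{i=0}^n\mathrm{g}_i(P)k^i$ for all $k\in\mathbb{N}$ (Ehrhart polynomial), defining $\mathrm{g}_i(P)$. For a $0$-symmetric convex body $K$ with nonempty interior, $\lambda_i(K)=\min\{\lambda>0:\dim(\lambda K\cap\mathbb{Z}^n)\ge i\}$ (dimension of the affine hull). $DP=P-P$ and $\sigma_i(P)=\sigma_i(1/\lambda_1(DP),\dots,1/\lambda_n(DP))$, with $\sigma_i$ the $i$th elementary symmetric polynomial ($\sigma_0=1$). *)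

(* Defs.v *)
From HB Require Import structures.
From mathcomp Require Import all_boot all_order all_algebra.
From mathcomp Require Import finmap boolp classical_sets functions cardinality reals.
Set Implicit Arguments. Unset Strict Implicit. Unset Printing Implicit Defensive.
Import Order.TTheory GRing.Theory Num.Theory.
Local Open Scope classical_set_scope.
Local Open Scope ring_scope.

Section Defs.
Variables (R : realType) (n : nat).

Definition lattice : set 'rV[R]_n := [set x | forall j, x ord0 j \is a Num.int].

Definition parallelepiped (p : 'rV[R]_n) (v : 'I_n -> 'rV[R]_n) : set 'rV[R]_n :=
  [set x | exists t : 'I_n -> R,
     (forall i, 0 <= t i <= 1) /\ x = p + \sum_(i < n) t i *: v i].

Definition dilate (l : R) (S : set 'rV[R]_n) : set 'rV[R]_n := [set l *: x | x in S].

Definition diffbody (S : set 'rV[R]_n) : set 'rV[R]_n :=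
  [set z | exists x y, S x /\ S y /\ z = x - y].

(* dim aff(S) >= d : some family of difference vectors a_i - b_i
   (a_i, b_i in S) has rank >= d; the direction space of aff(S) is
   spanned by such differences. *)
Definition affdim_ge (S : set 'rV[R]_n) (d : nat) : Prop :=
  exists (m : nat) (a b : 'I_m -> 'rV[R]_n),
    (forall i, S (a i) /\ S (b i)) /\
    (d <= \rank (\matrix_(i < m) (a i - b i)))%N.

(* n-dimensional set: dim aff(S) = n (it is always <= n in R^n) *)
Definition full_dim (S : set 'rV[R]_n) : Prop := affdim_ge S n.

Definition npoints (S : set 'rV[R]_n) : nat := (#|` fset_set (S `&` lattice) |)%fset.

Definition succmin (K : set 'rV[R]_n) (i : nat) : R :=
  inf [set l : R | 0 < l /\ affdim_ge (dilate l K `&` lattice) i].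

Definition sigma (P : set 'rV[R]_n) (i : nat) : R :=
  \sum_(I : {set 'I_n} | #|I| == i) \prod_(j in I) (succmin (diffbody P) j.+1)^-1.

End Defs.

(* Main.v *)
Require Import Defs.
From HB Require Import structures.
From mathcomp Require Import all_boot all_order all_algebra.
From mathcomp Require Import zify ring lra.
From mathcomp Require Import finmap boolp classical_sets functions cardinality reals.
Set Implicit Arguments. Unset Strict Implicit. Unset Printing Implicit Defensive.
Import Order.TTheory GRing.Theory Num.Theory.
Local Open Scope ring_scope.

(** Let [V] be the matrix of edge vectors and [D = |det V|].  In the coordinates
    [x = (t / D) V] the lattice Z^n becomes a lattice [L] between D Z^n and Z^n,
    and the difference body becomes the cube of half-side [D].  Sorting the points of
    the [q]-th dilate by the set [I] of coordinates that are [< q D] shows that g_i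
    is the sum over [|I| = i] of [D_I], the number of points of [L] in [[0,D)^I].

    Let [a_1, ..., a_n] in [L] realise the successive minima [l_1 <= ... <= l_n]
    of the cube.  Repeated symmetric basis exchange gives an injection [I |-> J(I)] with
    [|J(I)| = |I|] such that the [e_i], [i] in [I], and the [a_k], [k] not in [J(I)], form a
    basis.  Hence the [a]-coordinates with index in [J(I)] separate the points of
    [L_I = L /\ R^I], and a point of [L_I] of norm [< l_k] has [k]-th coordinate 0.

    Minkowski's second theorem for the cube in [R^I] then gives
    [D_I <= prod_(k in J(I)) D / l_k], and summing over [I] proves the claim.  Its proof is
    a discrete form of Minkowski's: a point [u] of [L_I] in a large cube is mapped
    to [sum_j (l_j - l_(j-1)) u_j], where [u_j] is a point of the cube chosen in terms of the
    coordinates of [u] with index [>= j] only; adding box points [sum_k w_k b_k] with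
    [w_k < l_k], for a triangular basis [b] of [L_I], gives a map injective modulo [N L_I]. *)

(** * Sup norm and integer forms on integer vectors *)

Definition supnorm n (v : 'rV[int]_n) : nat := (\max_(i < n) `|v 0%R i|)%N.

Lemma supnormP n (v : 'rV[int]_n) (m : nat) :
  reflect (forall i, (`|v 0%R i| <= m)%N) (supnorm v <= m)%N.
Proof.
apply: (iffP (bigmax_leqP _ _ _)) => [h i|h i _]; first exact: h.
exact: h.
Qed.

Lemma leq_supnorm n (v : 'rV[int]_n) i : (`|v 0%R i| <= supnorm v)%N.
Proof. by move: i; apply/supnormP. Qed.

Lemma supnormD n (u v : 'rV[int]_n) : (supnorm (u + v) <= supnorm u + supnorm v)%N.
Proof.
apply/supnormP => i; rewrite mxE.
move: (leq_supnorm u i) (leq_supnorm v i); move: (u 0 i) (v 0 i) => a b; lia.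
Qed.

Lemma supnormZ n (c : int) (v : 'rV[int]_n) : supnorm (c *: v) = (`|c| * supnorm v)%N.
Proof.
rewrite /supnorm; elim/big_rec2: _ => [|i m k _ ->]; first by rewrite muln0.
by rewrite mxE abszM maxnMr.
Qed.

Lemma zclosedZ n (L : zmodClosed 'rV[int]_n) (c : int) x : x \in L -> c *: x \in L.
Proof. by move=> Lx; rewrite -[c]intz scaler_int rpredMz. Qed.

Lemma raddf_intZ n (f : {additive 'rV[int]_n -> int}) (c : int) v : f (c *: v) = c * f v.
Proof. by rewrite -[c in LHS]intz scaler_int raddfMz -mulrzr intz mulrC. Qed.

(** * Triangular bases of lattices of integer vectors *)

(** The values of [alpha k] on the vectors of [L] killed by all forms of later index in [J] form an
    ideal of the integers, and [b k] is a vector at which a generator of this ideal is attained. *)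
Lemma triangular_basis n (L : zmodClosed 'rV[int]_n) (J : {set 'I_n})
    (alpha : 'I_n -> {additive 'rV[int]_n -> int}) :
  exists b : 'I_n -> 'rV[int]_n, forall k, k \in J ->
    [/\ b k \in L,
        forall j, j \in J -> (k < j)%N -> alpha j (b k) = 0 &
        forall v, v \in L -> (forall j, j \in J -> (k < j)%N -> alpha j v = 0) ->
          (alpha k (b k) %| alpha k v)%Z].
Proof.
suff /choice [b hb] : forall k : 'I_n, exists b : 'rV[int]_n,
    [/\ b \in L, forall j, j \in J -> (k < j)%N -> alpha j b = 0 &
        forall v, v \in L -> (forall j, j \in J -> (k < j)%N -> alpha j v = 0) ->
          (alpha k b %| alpha k v)%Z].
  by exists b => k _; apply: hb.
move=> k.
pose Lk v := v \in L /\ forall j, j \in J -> (k < j)%N -> alpha j v = 0.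
have LkB u v (c : int) : Lk u -> Lk v -> Lk (u - c *: v).
  move=> [Lu u0] [Lv v0]; split; first by rewrite rpredB // zclosedZ.
  move=> j jJ kj; rewrite raddfB /= raddf_intZ.
  by rewrite u0 // v0 // mulr0 subrr.
have [[v [Lkv nz]]|none] := pselect (exists v, Lk v /\ alpha k v != 0); last first.
  (* In this case the ideal is zero, so 0 serves as [b k]. *)
  exists 0; split=> [|j _ _|v Lv v0]; [exact: rpred0|exact: raddf0|].
  have [->|nz] := eqVneq (alpha k v) 0; first exact: dvdz0.
  by case: none; exists v.
pose P m := `[< exists v, [/\ Lk v, alpha k v != 0 & `|alpha k v|%N = m] >].
have exP : exists m, P m by exists `|alpha k v|%N; apply/asboolP; exists v.
case: (ex_minnP exP) => m /asboolP [b [[Lb b0] bnz bm]] minb.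
exists b; split=> // u Lu u0.
(* Division with remainder by the least nonzero value: a nonzero remainder would be a smaller
   value. *)
pose q := (alpha k u %/ alpha k b)%Z.
have E : alpha k (u - q *: b) = (alpha k u %% alpha k b)%Z.
  rewrite raddfB /= raddf_intZ.
  by rewrite /modz.
apply: contraT; rewrite dvdzE => /negP nd.
set x := u - q *: b in E *.
have /minb : P `|alpha k x|%N.
  apply/asboolP; exists x; split=> //; first exact: LkB.
  rewrite E; apply/negP => /eqP h0; apply: nd.
  by rewrite -dvdzE; apply/dvdz_mod0P.
rewrite E -bm leqNgt => /negP; case.
have := ltz_mod (alpha k u) bnz; have := modz_ge0 (alpha k u) bnz; lia.
Qed.

(** Elimination from the top index down: after [d] rounds the forms with index in [J] and at least
    [n - d] vanish on the remainder. After [n] rounds all of them do, and injectivity of the forms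
    makes the remainder 0. *)
Lemma basis_decomposition n (L : zmodClosed 'rV[int]_n) (J : {set 'I_n})
    (alpha : 'I_n -> {additive 'rV[int]_n -> int}) (b : 'I_n -> 'rV[int]_n) :
  (forall k, k \in J ->
    [/\ b k \in L,
        forall j, j \in J -> (k < j)%N -> alpha j (b k) = 0 &
        forall v, v \in L -> (forall j, j \in J -> (k < j)%N -> alpha j v = 0) ->
          (alpha k (b k) %| alpha k v)%Z]) ->
  (forall v, v \in L -> (forall k, k \in J -> alpha k v = 0) -> v = 0) ->
  forall v, v \in L -> exists c : 'I_n -> int, v = \sum_(k in J) c k *: b k.
Proof.
move=> hb inj v Lv.
suff H d : (d <= n)%N -> exists c : 'I_n -> int, forall j, j \in J -> (n - d <= j)%N ->
    alpha j (v - \sum_(k in J) c k *: b k) = 0.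
  have [c hc] := H n (leqnn n); exists c; apply/eqP; rewrite -subr_eq0; apply/eqP.
  apply: inj => [|k kJ]; last by apply: hc => //; rewrite subnn.
  by rewrite rpredB // rpred_sum // => k /hb [Lb _ _]; apply: zclosedZ.
elim: d => [_|d IH dn].
  by exists (fun=> 0) => j _; rewrite subn0 leqNgt ltn_ord.
have [c hc] := IH (ltnW dn).
have ltin : (n - d.+1 < n)%N by lia.
pose i := Ordinal ltin.
have [iJ|iJ] := boolP (i \in J); last first.
  exists c => j jJ; rewrite leq_eqVlt => /orP [/eqP ij|ij]; last by apply: hc => //; lia.
  by move: iJ; rewrite (_ : i = j) ?jJ //; apply: val_inj.
set r := v - _ in hc.
have Lr : r \in L.
  by rewrite rpredB // rpred_sum // => k /hb [Lb _ _]; apply: zclosedZ.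
have [Lb b0 bdiv] := hb i iJ.
have r0 j : j \in J -> (i < j)%N -> alpha j r = 0 by move=> jJ /= ij; apply: hc => //; lia.
have /dvdzP [q qE] := bdiv r Lr r0.
(* Only the coefficient of [b i] changes. The later forms kill [b i], so what is already cleared
   stays cleared. *)
exists (fun k => c k + (if k == i then q else 0)) => j jJ ij.
have -> : v - \sum_(k in J) (c k + (if k == i then q else 0)) *: b k = r - q *: b i.
  under eq_bigr do rewrite scalerDl.
  rewrite big_split /= opprD addrA -/r; congr (_ - _).
  rewrite (bigD1 i) //= eqxx big1 ?addr0 // => k /andP [_ /negPf ->].
  by rewrite scale0r.
rewrite raddfB /= raddf_intZ.
case: (ltngtP i j) => [ij'|ij'|/val_inj <-]; last by rewrite -qE subrr.
  by rewrite r0 // b0 // mulr0 subr0.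
by move: ij ij' => /=; lia.
Qed.

(** * Discrete form of Minkowski's second theorem *)

(** The convention is [l (-1) = 0]; the truncated subtraction is exact for nondecreasing [l]. *)
Definition increment (l : nat -> nat) (j : nat) : nat :=
  (l j - (if j is j'.+1 then l j' else 0))%N.

Lemma sum_increment (l : nat -> nat) n i : {homo l : x y / (x <= y)%N} -> (i < n)%N ->
  (\sum_(j < n | (j <= i)%N) increment l j)%N = l i.
Proof.
move=> mono ltin; rewrite big_mkcond /=.
rewrite -(big_mkord xpredT (fun j => if (j <= i)%N then increment l j else 0%N)).
rewrite (@big_cat_nat _ _ _ i.+1) //= [X in (_ + X)%N]big_nat.
rewrite [X in (_ + X)%N]big1 => [|j /andP [ij _]]; last by rewrite leqNgt ij.
rewrite addn0 big_nat (eq_bigr (increment l)) -?big_nat; last by move=> j /=; rewrite ltnS => ->.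
elim: i {ltin} => [|i IH]; first by rewrite big_nat1 /increment subn0.
by rewrite big_nat_recr //= IH /increment subnKC // mono.
Qed.

(* Depends only on the values [alpha k u] for [k >= j]. *)
Definition representative n (J : {set 'I_n}) (alpha : 'I_n -> {additive 'rV[int]_n -> int})
    (U : seq 'rV[int]_n) (j : nat) (u : 'rV[int]_n) : 'rV[int]_n :=
  nth 0 U (find (fun u' => [forall k, (k \in J) && (j <= k)%N ==> (alpha k u' == alpha k u)]) U).

Lemma representativeP n (J : {set 'I_n}) (alpha : 'I_n -> {additive 'rV[int]_n -> int}) U j u :
  u \in U ->
  representative J alpha U j u \in U /\
  forall k, k \in J -> (j <= k)%N -> alpha k (representative J alpha U j u) = alpha k u.
Proof.
move=> uU; set p := (fun u' => [forall k, (k \in J) && (j <= k)%N ==> (alpha k u' == alpha k u)]).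
have hp : has p U by apply/hasP; exists u => //; apply/forallP => k; rewrite eqxx implybT.
split; first by rewrite mem_nth // -has_find.
move=> k kJ jk; have /forallP/(_ k) := nth_find 0 hp.
by rewrite kJ jk => /eqP.
Qed.

Lemma eq_representative n (J : {set 'I_n}) (alpha : 'I_n -> {additive 'rV[int]_n -> int}) U j u u' :
  (forall k, k \in J -> (j <= k)%N -> alpha k u = alpha k u') ->
  representative J alpha U j u = representative J alpha U j u'.
Proof.
move=> h; rewrite /representative; congr nth; apply: eq_find => w /=.
apply: eq_forallb => k; case: (boolP (k \in J)) => //= kJ.
by case: (leqP j k) => //= jk; rewrite h.
Qed.

(** Minkowski's map. For [u] in [U] and [i] in [J], the form [alpha i] takes on the first sum the
    value [l i * alpha i u] plus terms determined by the coordinates of [u] beyond [i]. The second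
    sum, with [g k < l k], fills the gaps left by this stretching. *)
Definition spread n (J : {set 'I_n}) (alpha : 'I_n -> {additive 'rV[int]_n -> int})
    (l : nat -> nat) (b : 'I_n -> 'rV[int]_n) U (u : 'rV[int]_n) (g : 'I_n -> nat) : 'rV[int]_n :=
  \sum_(j < n) (increment l j)%:Z *: representative J alpha U j u
  + \sum_(k in J) (g k)%:Z *: b k.

(** A representative of level [j > i] sees only coordinates beyond [i], so it is the same for both
    points and cancels. *)
Lemma spread_sub n (J : {set 'I_n}) (alpha : 'I_n -> {additive 'rV[int]_n -> int}) l b U
    (i : 'I_n) u u' (g g' : 'I_n -> nat) :
  (forall k, k \in J -> (i < k)%N -> alpha k u = alpha k u' /\ g k = g' k) ->
  spread J alpha l b U u g - spread J alpha l b U u' g' =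
  \sum_(j < n | (j <= i)%N) (increment l j)%:Z *:
     (representative J alpha U j u - representative J alpha U j u')
  + \sum_(k in J | (k <= i)%N) ((g k)%:Z - (g' k)%:Z) *: b k.
Proof.
move=> h; rewrite /spread opprD addrACA -!sumrB.
congr (_ + _).
  rewrite [RHS]big_mkcond /=; apply: eq_bigr => j _; rewrite -scalerBr.
  case: leqP => // ij; rewrite (@eq_representative _ _ _ _ _ u u') ?subrr ?scaler0 //.
  by move=> k kJ jk; case: (h k kJ (leq_trans ij jk)).
rewrite [RHS]big_mkcondr /=; apply: eq_bigr => k kJ; rewrite -scalerBl.
case: leqP => // ik; case: (h k kJ ik) => _ ->; by rewrite subrr scale0r.
Qed.

Lemma supnorm_sum n (I : finType) (P : pred I) (F : I -> 'rV[int]_n) :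
  (supnorm (\sum_(i | P i) F i)%R <= \sum_(i | P i) supnorm (F i))%N.
Proof.
elim/big_rec2: _ => [|i y1 y2 _ h].
  by apply/supnormP => i; rewrite mxE.
by apply: leq_trans (supnormD _ _) _; rewrite leq_add2l.
Qed.

(** Descending induction on [i]. Once all coordinates beyond [i] agree, the difference is so short
    that [alpha i v = 0]; in the remaining equation [alpha i u] and [g i] are told apart like
    quotient and remainder modulo [l i]. *)
Lemma spread_separated n (L : zmodClosed 'rV[int]_n) (J : {set 'I_n})
    (alpha : 'I_n -> {additive 'rV[int]_n -> int}) (l : nat -> nat) (b : 'I_n -> 'rV[int]_n)
    (U : seq 'rV[int]_n) (T N : nat) u u' g g' v :
  {homo l : i j / (i <= j)%N} ->
  (forall v, v \in L -> (forall k, k \in J -> alpha k v = 0) -> v = 0) ->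
  (forall v k, v \in L -> k \in J -> (supnorm v < l k)%N -> alpha k v = 0) ->
  (forall k, k \in J ->
    [/\ b k \in L, alpha k (b k) != 0,
        forall j, j \in J -> (k < j)%N -> alpha j (b k) = 0 &
        forall v, v \in L -> (forall j, j \in J -> (k < j)%N -> alpha j v = 0) ->
          (alpha k (b k) %| alpha k v)%Z]) ->
  {subset U <= L} -> {in U &, forall u u' : 'rV[int]_n, (supnorm (u - u')%R <= T)%N} ->
  (T + \sum_(k in J) supnorm (b k) < N)%N ->
  u \in U -> u' \in U -> (forall k, k \in J -> (g k < l k)%N) ->
  (forall k, k \in J -> (g' k < l k)%N) -> v \in L ->
  spread J alpha l b U u g - spread J alpha l b U u' g' = N%:Z *: v ->
  u = u' /\ forall k, k \in J -> g k = g' k.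
Proof.
move=> mono inj minL hb UL UT TN uU u'U gl g'l Lv E.
suff H d : forall k : 'I_n, k \in J -> (n - d <= k)%N -> alpha k u = alpha k u' /\ g k = g' k.
  split; last by move=> k kJ; have [|//] := H n k kJ; rewrite subnn.
  apply/eqP; rewrite -subr_eq0; apply/eqP; apply: inj; first by rewrite rpredB // UL.
  move=> k kJ; rewrite raddfB /=; have [|-> _] := H n k kJ; first by rewrite subnn.
  by rewrite subrr.
elim: d => [k _|d IH i iJ id]; first by rewrite subn0 leqNgt ltn_ord.
have {IH} above k : k \in J -> (i < k)%N -> alpha k u = alpha k u' /\ g k = g' k.
  by move=> kJ ik; apply: IH => //; lia.
have := spread_sub l b U above; rewrite E => {}E.
have [Lbi bi0 bi_up bi_div] := hb i iJ.
have li0 : (0 < l i)%N by apply: leq_ltn_trans (gl i iJ).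
(* By telescoping, the first sum has norm at most [l i * T]; the second has at most [l i] times the
   sum of the norms of the [b k]. Hence [N * supnorm v < N * l i]. *)
have av0 : alpha i v = 0.
  apply: minL => //; rewrite -(@ltn_pmul2l N); last by apply: leq_ltn_trans TN.
  have <- : supnorm (N%:Z *: v) = (N * supnorm v)%N by rewrite supnormZ.
  rewrite E; apply: (@leq_ltn_trans (l i * (T + \sum_(k in J) supnorm (b k)))); last first.
    by rewrite [X in (_ < X)%N]mulnC ltn_pmul2l.
  apply: leq_trans (supnormD _ _) _; rewrite mulnDr; apply: leq_add.
    apply: leq_trans (supnorm_sum _ _) _.
    rewrite -(sum_increment mono (ltn_ord i)) big_distrl /=.
    apply: leq_sum => j ji; rewrite supnormZ leq_mul2l; apply/orP; right.
    by apply: UT; apply: (representativeP _ _ _ _).1.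
  apply: leq_trans (supnorm_sum _ _) _.
  rewrite big_distrr /= [X in (_ <= X)%N](bigID (fun k : 'I_n => (k <= i)%N)) /=.
  apply: leq_trans _ (leq_addr _ _); apply: leq_sum => k /andP [kJ ki].
  rewrite supnormZ leq_mul2r; apply/orP; right.
  have := gl k kJ; have := g'l k kJ; have := mono _ _ ki; lia.
have /(congr1 (alpha i)) := E; rewrite raddf_intZ av0 mulr0 raddfD !raddf_sum /=.
rewrite (eq_bigr (fun j : 'I_n => (increment l j)%:Z * (alpha i u - alpha i u'))); last first.
  move=> j ji; rewrite raddf_intZ raddfB /=.
  by rewrite (representativeP _ _ _ uU).2 // (representativeP _ _ _ u'U).2.
rewrite -big_distrl /= -(big_morph Posz PoszD (erefl _)) sum_increment //.
rewrite (bigD1 i) ?iJ ?leqnn //= big1 ?addr0; last first.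
  move=> k /andP [/andP [kJ ki] kni]; have [_ _ up _] := hb k kJ.
  rewrite raddf_intZ up ?mulr0 // ltn_neqAle ki andbT.
  by apply: contra kni => /eqP /val_inj ->.
have /dvdzP [t tE] : (alpha i (b i) %| alpha i (u - u'))%Z.
  apply: bi_div; first by rewrite rpredB // UL.
  by move=> j jJ ij; rewrite raddfB /=; have [-> _] := above j jJ ij; rewrite subrr.
rewrite raddfB /= in tE; rewrite raddf_intZ tE mulrA -mulrDl => /esym/eqP.
rewrite mulf_eq0 (negPf bi0) orbF => /eqP E0.
(* Up to sign, [t * l i] is a difference of two numbers in [[0, l i)]. *)
have t0 : t = 0 by have := gl i iJ; have := g'l i iJ; move: E0; clear; nia.
have gE : g i = g' i by move: E0; rewrite t0; lia.
split=> //; apply/eqP; rewrite -subr_eq0 tE t0 mul0r //.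
Qed.

(** The pairs of a point of [U] and a box point are sent by [spread] into [L], and their coordinates
    in the triangular basis are read modulo [N]. The constant [s] depends on this basis and not on
    [U], so it becomes negligible as [U] grows. *)
Lemma lattice_pigeonhole n (L : zmodClosed 'rV[int]_n) (J : {set 'I_n})
    (alpha : 'I_n -> {additive 'rV[int]_n -> int}) (l : nat -> nat) :
  {homo l : i j / (i <= j)%N} ->
  (forall v, v \in L -> (forall k, k \in J -> alpha k v = 0) -> v = 0) ->
  (forall k, k \in J -> exists2 v, v \in L &
     alpha k v != 0 /\ forall j, j \in J -> (k < j)%N -> alpha j v = 0) ->
  (forall v k, v \in L -> k \in J -> (supnorm v < l k)%N -> alpha k v = 0) ->
  exists s : nat, forall (U : seq 'rV[int]_n) (T N : nat),
    uniq U -> {subset U <= L} -> {in U &, forall u u' : 'rV[int]_n, (supnorm (u - u')%R <= T)%N} ->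
    (T + s < N)%N -> (size U * \prod_(k in J) l k <= N ^ #|J|)%N.
Proof.
move=> mono inj nondeg minL.
have [b hb] := triangular_basis L J alpha.
have decomp := basis_decomposition hb inj.
have {}hb k : k \in J ->
    [/\ b k \in L, alpha k (b k) != 0,
        forall j, j \in J -> (k < j)%N -> alpha j (b k) = 0 &
        forall v, v \in L -> (forall j, j \in J -> (k < j)%N -> alpha j v = 0) ->
          (alpha k (b k) %| alpha k v)%Z].
  move=> kJ; have [Lb b0 bdiv] := hb k kJ; split=> //.
  have [v Lv [vk0 v0]] := nondeg k kJ.
  by apply: contra vk0 => /eqP bk0; have := bdiv v Lv v0; rewrite bk0 dvd0z.
exists (\sum_(k in J) supnorm (b k))%N => U T [//|N] uU UL UT TN.
have /choice [c hc] : forall v, exists c : 'I_n -> int, v \in L -> v = \sum_(k in J) c k *: b k.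
  move=> v; have [Lv|] := boolP (v \in L); last by exists (fun=> 0).
  by have [c vE] := decomp v Lv; exists c.
(* A common bound puts all box coordinates into one ordinal type. The default [ord0] of [pfamily]
   pins them to 0 off [J], so that only the factors over [J] are counted. *)
pose B := (\max_(k < n) l k)%N.
pose W (k : 'I_n) : pred 'I_B.+1 := fun x => (x < l k)%N.
have cardW : (\prod_(k in J) l k)%N = #|pfamily ord0 J W|.
  rewrite card_pfamily /image_mem foldr_map -big_enum /= unlock /reducebig /=.
  elim: (enum J) => //= k s ->; congr muln.
  have lB : (l k <= B.+1)%N by apply: ltnW; rewrite ltnS /B (leq_bigmax k).
  have winj : injective (widen_ord lB) by move=> p q /(congr1 val) e; apply: val_inj.
  rewrite -{1}(card_ord (l k)) -(card_imset predT winj).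
  apply: eq_card => x; apply/imsetP/idP => [[y _ ->]|]; first exact: (ltn_ord y).
  rewrite unfold_in => xl; exists (Ordinal xl) => //; exact: val_inj.
pose z (x : 'I_(size U) * {ffun 'I_n -> 'I_B.+1}) :=
  spread J alpha l b U (nth 0 U x.1) (fun k => x.2 k).
pose A := [set x : 'I_(size U) * {ffun 'I_n -> 'I_B.+1} | x.2 \in pfamily ord0 J W].
have cardA : #|A| = (size U * \prod_(k in J) l k)%N.
  have -> : A = finset.setX [set: 'I_(size U)] [set g in pfamily ord0 J W].
    by apply/setP => x; rewrite !inE.
  by rewrite cardsX cardsT card_ord cardW cardsE.
(* Equal values of [f] mean that the two spread points differ by an element of [N.+1] times [L]. *)
pose f x : {ffun 'I_n -> 'I_N.+1} :=
  [ffun k => if k \in J then inord `|(c (z x) k %% N.+1)%Z|%N else ord0].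
rewrite -cardA -[X in (_ <= X ^ _)%N]card_ord -(card_pffun_on ord0 J predT).
have Uz i : (i < size U)%N -> nth 0 U i \in U by move=> ?; rewrite mem_nth.
have Lz x : z x \in L.
  rewrite rpredD // rpred_sum // => k hk; apply: zclosedZ.
    by apply: UL; apply: (representativeP _ _ _ _).1; apply: Uz.
  by have [] := hb k hk.
have finj : {in A &, injective f}.
  move=> x y xA yA fxy.
  have modE k : k \in J -> exists q : int, c (z x) k - c (z y) k = N.+1%:Z * q.
    move=> kJ; have /ffunP/(_ k) := fxy; rewrite !ffunE kJ => /(congr1 val) /=.
    have bnd (m : int) : (`|(m %% N.+1)%Z| < N.+1)%N.
      have := @ltz_mod m N.+1%:Z isT; have := @modz_ge0 m N.+1%:Z isT; lia.
    rewrite !inordK ?bnd // => h.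
    exists ((c (z x) k %/ N.+1)%Z - (c (z y) k %/ N.+1)%Z).
    rewrite {1}(divz_eq (c (z x) k) N.+1) {1}(divz_eq (c (z y) k) N.+1).
    have := @modz_ge0 (c (z x) k) N.+1%:Z isT; have := @modz_ge0 (c (z y) k) N.+1%:Z isT.
    move: h; move: (_ %% _)%Z (_ %% _)%Z (_ %/ _)%Z (_ %/ _)%Z => r1 r2 q1 q2; lia.
  have /choice [q hq] : forall k, exists q : int, k \in J -> c (z x) k - c (z y) k = N.+1%:Z * q.
    by move=> k; have [kJ|] := boolP (k \in J); [have [q] := modE k kJ; exists q|exists 0].
  have E : z x - z y = N.+1%:Z *: \sum_(k in J) q k *: b k.
    rewrite {1}(hc _ (Lz x)) {1}(hc _ (Lz y)) -sumrB scaler_sumr; apply: eq_bigr => k kJ.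
    by rewrite -scalerBl hq // scalerA.
  have Lq : \sum_(k in J) q k *: b k \in L.
    by rewrite rpred_sum // => k kJ; apply: zclosedZ; have [] := hb k kJ.
  move: xA yA; rewrite !inE => /pfamilyP [sx xW] /pfamilyP [sy yW].
  have [u_eq g_eq] : nth 0 U x.1 = nth 0 U y.1 /\ forall k, k \in J -> x.2 k = y.2 k :> nat.
    by apply: (spread_separated mono inj minL hb UL UT TN _ _ _ _ Lq E) => //; apply: Uz.
  case: x y u_eq g_eq sx xW sy yW {fxy modE hq E} => [i1 g1] [i2 g2] /= u_eq g_eq sx xW sy yW.
  congr (_, _); first by apply/val_inj/eqP; rewrite -(nth_uniq 0 (ltn_ord i1) (ltn_ord i2) uU) u_eq.
  apply/ffunP => k; apply: val_inj; have [kJ|kJ] := boolP (k \in J); first exact: g_eq.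
  have off (g : {ffun 'I_n -> 'I_B.+1}) : ord0.-support g \subset J -> g k = ord0.
    by move=> /fintype.subsetP/(_ k) h; apply/eqP; apply: contraNT kJ => /h.
  by rewrite (off g1) // (off g2).
rewrite -(card_in_imset finj); apply/subset_leq_card/fintype.subsetP => _ /imsetP [x _ ->].
apply/pffun_onP; split=> //; apply/fintype.subsetP => k; rewrite inE /= ffunE.
by case: ifP => //; rewrite eqxx.
Qed.

(** Comparison of leading coefficients in [q], with an explicit error term in place of a limit. *)
Lemma leq_exp_of_growth (X D s m : nat) :
  (forall q, (0 < q)%N -> (X * q ^ m <= (q * D + s) ^ m)%N) -> (X <= D ^ m)%N.
Proof.
move=> h.
have [C hC] : exists C, forall q, (0 < q)%N -> (q * (q * D + s) ^ m <= (D ^ m * q + C) * q ^ m)%N.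
  elim: m {h} => [|m [C IH]]; first by exists 0%N => q _; rewrite !expn0; lia.
  exists (D ^ m * s + C * D + C * s)%N => q q0; rewrite !expnSr mulnA.
  apply: leq_trans (leq_mul (IH q q0) (leqnn _)) _.
  move: (q ^ m)%N (D ^ m)%N => w d.
  have H : ((d * q + C) * (q * D + s) <= (d * D * q + (d * s + C * D + C * s)) * q)%N by nia.
  by have := leq_mul H (leqnn w); rewrite -!mulnA [(_ * w)%N]mulnC [(w * q)%N]mulnC.
(* At [q = C + 1] the bounds give [X * q <= D ^ m * q + C] with [C < q]. *)
have := leq_mul (leqnn C.+1) (h C.+1 isT) => /leq_trans/(_ (hC C.+1 isT)).
rewrite mulnA leq_pmul2r ?expn_gt0 //; nia.
Qed.

(** * The lattice in edge coordinates and its boxes *)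

(** This is [L_I]: divisibility of [t *m V] by [D] says that the point with edge coordinates [t / D]
    is integral. Keeping [t] integral allows the lattice argument to run over the integers. *)
Definition sublattice n (V : 'M[int]_n) (D : nat) (I : {set 'I_n}) : {pred 'rV[int]_n} :=
  fun t => [forall j, (D%:Z %| (t *m V) 0%R j)%Z] && [forall i, (i \notin I) ==> (t 0 i == 0)].

Lemma sublatticeP n (V : 'M[int]_n) (D : nat) (I : {set 'I_n}) t :
  reflect ((forall j, (D%:Z %| (t *m V) 0%R j)%Z) /\ forall i, i \notin I -> t 0 i = 0)
    (t \in sublattice V D I).
Proof.
rewrite unfold_in; apply: (iffP andP) => [[/forallP h1 /forallP h2]|[h1 h2]].
  by split=> // i iI; have := h2 i; rewrite iI => /eqP.
split; first by apply/forallP.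
apply/forallP => i; apply/implyP => iI; apply/eqP; exact: h2.
Qed.

Lemma sublattice_zmod_closed n (V : 'M[int]_n) (D : nat) (I : {set 'I_n}) :
  zmod_closed (sublattice V D I).
Proof.
split=> [|x y /sublatticeP [x1 x2] /sublatticeP [y1 y2]]; apply/sublatticeP.
  by split=> [j|i _]; rewrite ?mul0mx mxE ?dvdz0.
split=> [j|i iI]; last by rewrite !mxE x2 // y2 // subrr.
by rewrite mulmxBl !mxE; have := x1 j; have := y1 j; rewrite !mxE => ? ?; rewrite rpredB.
Qed.

HB.instance Definition _ n (V : 'M[int]_n) (D : nat) (I : {set 'I_n}) :=
  GRing.isZmodClosed.Build _ (sublattice V D I) (sublattice_zmod_closed V D I).

Lemma scaled_in_sublattice n (V : 'M[int]_n) (D : nat) (I : {set 'I_n}) (t : 'rV[int]_n) :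
  (forall i, i \notin I -> t 0 i = 0) -> D%:Z *: t \in sublattice V D I.
Proof.
move=> h; apply/sublatticeP; split=> [j|i iI]; last by rewrite mxE h // mulr0.
by rewrite -scalemxAl mxE dvdz_mulr.
Qed.

Definition box_vector n T (f : {ffun 'I_n -> 'I_T}) : 'rV[int]_n := \row_i (f i : nat)%:Z.

Lemma box_vector_inj n T : injective (@box_vector n T).
Proof.
move=> f g /matrixP h; apply/ffunP => i; apply: val_inj.
by have := h 0 i; rewrite !mxE => -[].
Qed.

(** Membership in the sublattice forces the coordinates off [I] to be 0, so this is the half-open
    box [[0, T)^I]. For [T = D] its cardinality is [D_I]. *)
Definition lattice_box n (V : 'M[int]_n) (D : nat) (I : {set 'I_n}) (T : nat) :
    {set {ffun 'I_n -> 'I_T}} :=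
  [set f | box_vector f \in sublattice V D I].

(** The lattice contains [D] times every integer vector supported on [I]. Division of each
    coordinate by [D] therefore cuts the large box into [q ^ #|I|] translates of the small one, all
    with equally many lattice points. *)
Lemma card_lattice_box n (V : 'M[int]_n) (D q : nat) (I : {set 'I_n}) :
  (0 < D)%N -> (0 < q)%N ->
  #|lattice_box V D I (q * D)| = (#|lattice_box V D I D| * q ^ #|I|)%N.
Proof.
move=> D0; case: q => // q _.
have bnd (a : 'I_D) (c : 'I_q.+1) : (c * D + a < q.+1 * D)%N.
  by have := ltn_ord a; have := ltn_ord c; nia.
pose A := [set x : {ffun 'I_n -> 'I_D} * {ffun 'I_n -> 'I_q.+1} |
  (x.1 \in lattice_box V D I D) && (x.2 \in pffun_on ord0 I predT)].
have cardA : #|A| = (#|lattice_box V D I D| * q.+1 ^ #|I|)%N.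
  have -> : A = finset.setX (lattice_box V D I D) [set g in pffun_on ord0 I predT].
    by apply/setP => x; rewrite !inE.
  by rewrite cardsX -[in RHS](card_ord q.+1) -(card_pffun_on ord0 I predT); congr muln; rewrite cardsE.
pose h (x : {ffun 'I_n -> 'I_D} * {ffun 'I_n -> 'I_q.+1}) :
    {ffun 'I_n -> 'I_(q.+1 * D)} := [ffun i => Ordinal (bnd (x.1 i) (x.2 i))].
have hinj : injective h.
  move=> [f g] [f' g'] /ffunP e; congr (_, _); apply/ffunP => i; apply: val_inj;
    have /(congr1 val) := e i; rewrite !ffunE /= => {}e.
    by have := congr1 (modn^~ D) e; rewrite /= !modnMDl !modn_small.
  by have := congr1 (divn^~ D) e; rewrite /= !divnMDl // !divn_small // !addn0.
have hE x : box_vector (h x) = box_vector x.1 + D%:Z *: box_vector x.2.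
  by apply/rowP => i; rewrite !mxE ffunE /=; lia.
have off (g : {ffun 'I_n -> 'I_q.+1}) : g \in pffun_on ord0 I predT ->
    forall i, i \notin I -> box_vector g 0 i = 0.
  move=> /pffun_onP [/fintype.subsetP sg _] i iI; rewrite mxE.
  have -> // : g i = ord0 by apply/eqP; apply: contraNT iI => /sg.
rewrite -cardA -(card_imset _ hinj); apply: eq_card => f; apply/idP/imsetP; last first.
  move=> [x]; rewrite inE => /andP [x1 x2] ->; move: x1; rewrite !inE hE => x1.
  by rewrite rpredD // scaled_in_sublattice //; apply: off.
have fm i : (f i %% D < D)%N by rewrite ltn_mod.
have fd i : (f i %/ D < q.+1)%N by rewrite ltn_divLR.
rewrite inE => Lf0; have Lf : box_vector f \in sublattice V D I by exact: Lf0.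
pose x : {ffun 'I_n -> 'I_D} * {ffun 'I_n -> 'I_q.+1} :=
  ([ffun i => Ordinal (fm i)], [ffun i => Ordinal (fd i)]).
have fE : f = h x.
  by apply/ffunP => i; apply: val_inj; rewrite !ffunE /= -divn_eq.
have supp i : i \notin I -> f i = 0%N :> nat.
  by move=> iI; have /sublatticeP [_ /(_ i iI)] := Lf; rewrite mxE => e; apply/eqP; rewrite -eqz_nat e.
have x2 : x.2 \in pffun_on ord0 I predT.
  apply/pffun_onP; split => //.
  apply/fintype.subsetP => i; rewrite inE ffunE; apply: contraNT => iI.
  by apply/eqP/val_inj; rewrite /= supp // div0n.
exists x => //; rewrite inE x2 andbT inE.
have -> : box_vector x.1 = box_vector f - D%:Z *: box_vector x.2 by rewrite fE hE addrK.
by rewrite rpredB // scaled_in_sublattice //; apply: off.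
Qed.

(** * Spans of families and symmetric basis exchange *)

Definition family_span (F : fieldType) (T : finType) n (w : T -> 'rV[F]_n) (X : {set T}) :
  'M[F]_n := (\sum_(x in X) <<w x>>)%MS.

Lemma mem_family_span (F : fieldType) (T : finType) n (w : T -> 'rV[F]_n) (X : {set T}) x :
  x \in X -> (w x <= family_span w X)%MS.
Proof. by move=> xX; rewrite (sumsmx_sup x) ?genmxE. Qed.

Lemma family_spanP (F : fieldType) (T : finType) m n (w : T -> 'rV[F]_n) (X : {set T})
    (B : 'M[F]_(m, n)) :
  reflect (forall x, x \in X -> (w x <= B)%MS) (family_span w X <= B)%MS.
Proof. by apply: (iffP sumsmx_subP) => h x xX; have := h x xX; rewrite genmxE. Qed.

Lemma family_spanS (F : fieldType) (T : finType) n (w : T -> 'rV[F]_n) (X Y : {set T}) :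
  X \subset Y -> (family_span w X <= family_span w Y)%MS.
Proof.
by move=> /fintype.subsetP XY; apply/family_spanP => x /XY; apply: mem_family_span.
Qed.

Lemma rank_family_span (F : fieldType) (T : finType) n (w : T -> 'rV[F]_n) (X : {set T}) :
  (\rank (family_span w X) <= #|X|)%N.
Proof.
rewrite -sum1_card /family_span; elim/big_rec2: _ => [|x k B _ h]; first by rewrite mxrank0.
apply: leq_trans (mxrank_adds_leqif _ _).1 (leq_add _ h).
by rewrite mxrank_gen rank_leq_row.
Qed.

Lemma row_fullS (F : fieldType) m1 m2 n (A : 'M[F]_(m1, n)) (B : 'M[F]_(m2, n)) :
  row_full A -> (A <= B)%MS -> row_full B.
Proof. by rewrite -!sub1mx; apply: submx_trans. Qed.

Lemma family_spanD1 (F : fieldType) (T : finType) m n (w : T -> 'rV[F]_n) (X : {set T}) y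
    (B : 'M[F]_(m, n)) :
  (family_span w (X :\ y) <= B)%MS -> (w y <= B)%MS -> (family_span w X <= B)%MS.
Proof.
move=> /family_spanP h yB; apply/family_spanP => x xX.
by have [->//|xy] := eqVneq x y; apply: h; rewrite !inE xy.
Qed.

(** Expand [w e] over [S :|: A]. Since [w e] lies outside the hyperplane [H] spanned by [S] and
    [E :\ e], so does some term of the expansion, say at [q]. Then [q] completes [H], and its
    nonzero coefficient allows [e] to replace it. *)
Lemma symmetric_exchange (F : fieldType) (T : finType) n (w : T -> 'rV[F]_n)
    (S E A : {set T}) e :
  e \in E -> (#|S| + #|E| <= n)%N ->
  row_full (family_span w (S :|: E)) -> row_full (family_span w (S :|: A)) ->
  exists2 q, q \in A & row_full (family_span w (q |: S :|: (E :\ e))) /\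
                       row_full (family_span w (e |: S :|: (A :\ q))).
Proof.
move=> eE cSE fE fA; set H := family_span w (S :|: (E :\ e)).
have cE := cardsD1 e E; rewrite eE in cE.
(* [H] is spanned by fewer than [n] vectors; with [w e] added it has full rank, so its rank is
   exactly [n - 1]. *)
have rH : (\rank H < n)%N.
  apply: leq_ltn_trans (rank_family_span _ _) _; apply: leq_ltn_trans (leq_card_setU _ _) _.
  by move: cSE; rewrite cE; lia.
have eH : ~~ (w e <= H)%MS.
  apply/negP => eH; move: rH; rewrite ltnNge; case/negP.
  have : row_full H.
    apply: row_fullS fE _; apply: (@family_spanD1 _ _ _ _ _ _ e) => //.
    by apply: family_spanS; apply/fintype.subsetP => x; rewrite !inE => /andP [-> ->].
  by rewrite /row_full => /eqP ->.
have rH1 : (n <= (\rank H).+1)%N.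
  have /eqP {1}<- : row_full (H + w e)%MS.
    apply: row_fullS fE _; apply: (@family_spanD1 _ _ _ _ _ _ e); last exact: addsmxSr.
    apply: submx_trans (addsmxSl _ _); apply: family_spanS.
    by apply/fintype.subsetP => x; rewrite !inE => /andP [-> ->].
  apply: leq_trans (mxrank_adds_leqif _ _).1 _.
  by have := rank_leq_row (w e); lia.
have /sub_sumsmxP [u uE] := submx_full (w e) fA.
have [q qSA nq] : exists2 q, q \in S :|: A & ~~ (u q *m <<w q>> <= H)%MS.
  apply/exists_inP; apply: contraNT eH => /exists_inPn h.
  by rewrite uE summx_sub // => x /h; rewrite negbK.
have nqH : ~~ (w q <= H)%MS.
  by apply: contra nq => qH; apply: submx_trans (submxMl _ _) _; rewrite genmxE.
have qA : q \in A.
  move: qSA; rewrite inE => /orP [qS|//].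
  by case/negP: nqH; apply: mem_family_span; rewrite inE qS.
have /sub_rVP [c cE'] : (u q *m <<w q>> <= w q)%MS by apply: submx_trans (submxMl _ _) _; rewrite genmxE.
exists q => //; split.
  have /eqP fq : \rank (H + w q)%MS == n.
    rewrite eqn_leq rank_leq_col; apply: leq_trans rH1 _.
    suff : (H < H + w q)%MS by rewrite ltmxErank => /andP [].
    by rewrite ltmxE addsmxSl addsmx_sub submx_refl.
  apply: (@row_fullS _ _ _ _ (H + w q)%MS); first by rewrite /row_full fq.
  rewrite addsmx_sub mem_family_span ?andbT ?inE ?eqxx //.
  by apply: family_spanS; apply/fintype.subsetP => x; rewrite !inE => /orP [->|->]; rewrite ?orbT.
set G := family_span w _.
have GS x : x \in S :|: A -> x != q -> (w x <= G)%MS.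
  by move=> xSA xq; apply: mem_family_span; move: xSA; rewrite !inE xq => /orP [->|->]; rewrite ?orbT.
apply: row_fullS fA _; apply: (@family_spanD1 _ _ _ _ _ _ q).
  by apply/family_spanP => x; rewrite inE => /andP [xq xSA]; apply: GS => //; rewrite inE in xq.
have c0 : c != 0 by apply: contra nq => /eqP c0; rewrite cE' c0 scale0r sub0mx.
rewrite -[w q]scale1r -(mulVf c0) -scalerA -cE' scalemx_sub //.
have -> : u q *m <<w q>>%MS = w e - \sum_(x in S :|: A | x != q) u x *m <<w x>>%MS.
  by rewrite {1}uE (bigD1 q) //= addrK.
rewrite addmx_sub ?eqmx_opp //; first by apply: mem_family_span; rewrite !inE eqxx.
apply: summx_sub => x /andP [xSA xq].
by apply: submx_trans (submxMl _ _) _; rewrite genmxE GS.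
Qed.

(** Exchange a fixed [e] of [E] for some [q] of [A] and recurse twice: sets containing [e] are
    treated with [e] moved into [S], and [q] is added to their image; the others are treated with
    [q] moved into [S]. Whether the image contains [q] tells the two cases apart, which gives
    injectivity. *)
Lemma basis_exchange_matching (F : fieldType) (T : finType) n (w : T -> 'rV[F]_n) m :
  forall S E A : {set T}, #|E| = m -> #|A| = m -> (#|S| + m <= n)%N ->
  row_full (family_span w (S :|: E)) -> row_full (family_span w (S :|: A)) ->
  exists2 f : {set T} -> {set T}, {in powerset E &, injective f} &
    forall X : {set T}, X \subset E -> [/\ f X \subset A, #|f X| = #|X| &
      row_full (family_span w (S :|: X :|: (A :\: f X)))].
Proof.
elim: m => [|m IH] S E A cE cA cS fE fA.
  have E0 : E = finset.set0 by apply/eqP; rewrite -cards_eq0 cE.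
  exists id => [//|X]; rewrite E0 finset.subset0 => /eqP ->; rewrite finset.sub0set; split=> //.
  by rewrite finset.setU0 finset.setD0.
have [e eE] : exists e, e \in E by apply/set0Pn; rewrite -card_gt0 cE.
have [|q qA [fq fe]] := symmetric_exchange eE _ fE fA; first by rewrite cE.
have cE' : #|E :\ e| = m by move: cE; rewrite (cardsD1 e) eE => -[].
have cA' : #|A :\ q| = m by move: cA; rewrite (cardsD1 q) qA => -[].
have cS1 x : (#|x |: S| + m <= n)%N by rewrite cardsU1; move: cS; case: (x \notin S); lia.
have fE1 : row_full (family_span w ((e |: S) :|: (E :\ e))).
  apply: row_fullS fE _; apply: family_spanS; apply/fintype.subsetP => x; rewrite !inE.
  by case: (x == e) => //=.
have fA2 : row_full (family_span w ((q |: S) :|: (A :\ q))).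
  apply: row_fullS fA _; apply: family_spanS; apply/fintype.subsetP => x; rewrite !inE.
  by case: (x == q) => //=.
have [f1 inj1 h1] := IH _ _ _ cE' cA' (cS1 e) fE1 fe.
have [f2 inj2 h2] := IH _ _ _ cE' cA' (cS1 q) fq fA2.
pose f (X : {set T}) := if e \in X then q |: f1 (X :\ e) else f2 X.
have D1 (X : {set T}) : X \subset E -> X :\ e \subset E :\ e by apply: finset.setSD.
have D2 (X : {set T}) : X \subset E -> e \notin X -> X \subset E :\ e.
  by move=> XE eX; rewrite finset.subsetD1 XE.
have q1 (X : {set T}) : X \subset E -> q \notin f1 (X :\ e).
  by move=> /D1 /h1 [/fintype.subsetP/(_ q) h _ _]; apply/negP => /h; rewrite !inE eqxx.
have q2 (X : {set T}) : X \subset E -> e \notin X -> q \notin f2 X.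
  move=> XE eX; have [/fintype.subsetP/(_ q) h _ _] := h2 _ (D2 _ XE eX).
  by apply/negP => /h; rewrite !inE eqxx.
exists f => [X Y|X XE].
  rewrite !powersetE => XE YE; rewrite /f.
  case: ifPn => eX; case: ifPn => eY fXY.
  - rewrite -(finset.setD1K eX) -(finset.setD1K eY); congr (_ |: _); apply: inj1.
    + by rewrite powersetE D1.
    + by rewrite powersetE D1.
    by rewrite -(finset.setU1K (q1 _ XE)) fXY finset.setU1K // q1.
  - by have := q2 _ YE eY; rewrite -fXY !inE eqxx.
  - by have := q2 _ XE eX; rewrite fXY !inE eqxx.
  - by apply: inj2 fXY; rewrite powersetE D2.
rewrite /f; case: ifPn => eX.
  have [s1 c1 f1f] := h1 _ (D1 _ XE); split.
  - apply/fintype.subsetP => x; rewrite inE => /orP [|]; first by rewrite inE => /eqP ->.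
    by move/(fintype.subsetP s1); rewrite inE => /andP [].
  - by rewrite cardsU1 q1 // c1 [in RHS](cardsD1 e) eX.
  apply: row_fullS f1f _; apply: family_spanS; apply/fintype.subsetP => x; rewrite !inE.
  by case: eqP => [->|_]; [rewrite eX !orbT|]; case: (x == q); case: (x \in S); case: (x \in X); case: (x \in f1 _).
have [s2 c2 f2f] := h2 _ (D2 _ XE eX); split=> //.
  by apply: fintype.subset_trans s2 _; apply: finset.subsetDl.
apply: row_fullS f2f _; apply: family_spanS; apply/fintype.subsetP => x; rewrite !inE.
case: eqP => [->|_]; first by rewrite qA (q2 _ XE eX) !orbT.
by case: (x \in S); case: (x \in X); case: (x \in f2 _).
Qed.

(** * Successive minima of the cube *)

Notation ratv := (map_mx (intr : int -> rat)).

(** The vectors [D e_i] of [L] span, so some vector of [L] leaves a proper subspace; take a shortest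
    such vector. *)
Lemma greedy_step n (L : zmodClosed 'rV[int]_n) (D : nat) (B : 'M[rat]_n) :
  (0 < D)%N -> (forall i, D%:Z *: delta_mx 0 i \in L) -> (\rank B < n)%N ->
  exists v, [/\ v \in L, ~~ (ratv v <= B)%MS &
    forall u, u \in L -> (supnorm u < supnorm v)%N -> (ratv u <= B)%MS].
Proof.
move=> D0 hL rB.
pose P m := `[< exists v, [/\ v \in L, ~~ (ratv v <= B)%MS & supnorm v = m] >].
have exP : exists m, P m.
  have [i hi] : exists i : 'I_n, ~~ ((delta_mx 0 i : 'rV[rat]_n) <= B)%MS.
    apply: contrapT => nex; move: rB; apply/negP.
    rewrite -leqNgt -[X in (X <= _)%N](mxrank1 rat) mxrankS //; apply/row_subP => i.
    by rewrite rowE mulmx1; apply: contrapT => /negP h; apply: nex; exists i.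
  exists (supnorm (D%:Z *: delta_mx 0 i : 'rV[int]_n)); apply/asboolP.
  exists (D%:Z *: delta_mx 0 i); split=> //; rewrite map_mxZ map_delta_mx.
  apply: contra hi => h; rewrite -[delta_mx 0 i]scale1r -(@mulVf _ (D%:~R : rat)).
    by rewrite -scalerA scalemx_sub.
  by rewrite intr_eq0 -lt0n.
case: (ex_minnP exP) => m /asboolP [v [Lv vB <-]] minv; exists v; split=> // u Lu.
apply: contraTT => uB; rewrite -leqNgt; apply: minv; apply/asboolP; by exists u.
Qed.

(** Greedy choice: [a j] is a shortest vector of [L] outside the span of its predecessors. A
    candidate at a later stage is also one at every earlier stage, whence the norms are
    nondecreasing. *)
Lemma successive_basis n (L : zmodClosed 'rV[int]_n) (D : nat) :
  (0 < D)%N -> (forall i, D%:Z *: delta_mx 0 i \in L) ->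
  exists a : 'I_n -> 'rV[int]_n, exists l : nat -> nat,
    [/\ {homo l : i j / (i <= j)%N},
        forall j : 'I_n, [/\ a j \in L, supnorm (a j) = l j & (0 < l j)%N],
        row_full (family_span (fun i => ratv (a i)) [set: 'I_n]) &
        forall v (k : 'I_n), v \in L -> (supnorm v < l k)%N ->
          (ratv v <= family_span (fun i => ratv (a i)) [set i : 'I_n | (i < k)%N])%MS].
Proof.
move=> D0 hL.
have /choice [next nextP] : forall B : 'M[rat]_n, exists v, (\rank B < n)%N ->
    [/\ v \in L, ~~ (ratv v <= B)%MS &
    forall u, u \in L -> (supnorm u < supnorm v)%N -> (ratv u <= B)%MS].
  move=> B; case: (ltnP (\rank B) n) => [/(greedy_step D0 hL) [v vP]|_]; last by exists 0.
  by exists v.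
pose B j : 'M[rat]_n := iter j (fun B => (B + <<ratv (next B)>>)%MS) 0.
have BS j : (B j <= B j.+1)%MS by apply: addsmxSl.
have Ble i j : (i <= j)%N -> (B i <= B j)%MS.
  elim: j => [|j IH]; first by rewrite leqn0 => /eqP ->.
  rewrite leq_eqVlt ltnS => /predU1P [->//|/IH h]; exact: submx_trans h (BS j).
have memB j : (ratv (next (B j)) <= B j.+1)%MS.
  by apply: submx_trans (addsmxSr _ _); rewrite genmxE.
have rankB_le j : (\rank (B j) <= j)%N.
  elim: j => [|j IH]; first by rewrite mxrank0.
  apply: leq_trans (mxrank_adds_leqif _ _).1 _; rewrite mxrank_gen.
  by rewrite -[j.+1]addn1 leq_add // rank_leq_row.
have stepP j : (j < n)%N -> [/\ next (B j) \in L, ~~ (ratv (next (B j)) <= B j)%MS &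
    forall u, u \in L -> (supnorm u < supnorm (next (B j)))%N -> (ratv u <= B j)%MS].
  by move=> jn; apply: nextP; apply: leq_ltn_trans (rankB_le j) jn.
have rankB_ge j : (j <= n)%N -> (j <= \rank (B j))%N.
  elim: j => // j IH jn; apply: leq_ltn_trans (IH (ltnW jn)) _.
  suff : (B j < B j.+1)%MS by rewrite ltmxErank => /andP [].
  have [_ nB _] := stepP j jn; rewrite ltmxE BS /=; apply: contra nB.
  exact: submx_trans (memB j).
pose a (i : 'I_n) := next (B i).
have Bspan j : (B j <= family_span (fun i => ratv (a i)) [set i : 'I_n | (i < j)%N])%MS \/ (n < j)%N.
  elim: j => [|j [IH|IH]]; [by left; apply: sub0mx| |by right; lia].
  case: (ltnP j n) => jn; [left|by right].
  rewrite addsmx_sub (submx_trans IH) /=; last first.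
    by apply: family_spanS; apply/fintype.subsetP => x; rewrite !inE; lia.
  by rewrite genmxE (@mem_family_span _ _ _ (fun i => ratv (a i)) _ (Ordinal jn)) // inE.
have {}Bspan j : (j <= n)%N -> (B j <= family_span (fun i => ratv (a i)) [set i : 'I_n | (i < j)%N])%MS.
  by move=> jn; case: (Bspan j) => //; lia.
have minP i j : (i <= j)%N -> (j < n)%N -> (supnorm (next (B i)) <= supnorm (next (B j)))%N.
  move=> ij jn; have [_ _ h] := stepP i (leq_ltn_trans ij jn); have [Lj nj _] := stepP j jn.
  by rewrite leqNgt; apply: contra nj => /(h _ Lj) /submx_trans; apply; apply: Ble.
(* Clamping the index at [n - 1] makes [l] nondecreasing on all natural numbers. *)
exists a, (fun j => supnorm (next (B (minn j n.-1)))); split.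
- move=> i j ij; case: (posnP n) => n0; last by apply: minP; lia.
  by have -> : minn i n.-1 = minn j n.-1 by lia.
- move=> j; have -> : minn j n.-1 = j by have := ltn_ord j; lia.
  have [Lj nj _] := stepP j (ltn_ord j); split=> //.
  rewrite lt0n; apply: contra nj => /eqP s0.
  have -> : next (B j) = 0; last by rewrite raddf0 sub0mx.
  apply/rowP => i; rewrite mxE; apply/eqP; rewrite -absz_eq0 -leqn0.
  by have := leq_supnorm (next (B j)) i; rewrite s0.
- have fB : row_full (B n) by rewrite /row_full eqn_leq rank_leq_col rankB_ge.
  by apply: row_fullS fB _; apply: submx_trans (Bspan n (leqnn n)) _; apply: family_spanS; rewrite finset.subsetT.
move=> v k Lv; have -> : minn k n.-1 = k by have := ltn_ord k; lia.
move=> vk; have [_ _ h] := stepP k (ltn_ord k).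
by apply: submx_trans (h v Lv vk) (Bspan k _); apply: ltnW.
Qed.

(** * The bound for one coordinate subspace *)

(** For [M = \adj A] with [A] invertible over the rationals, this is [\det A] times the [k]-th
    coordinate in the basis of rows of [A], an integral form. *)
Definition row_form n (M : 'M[int]_n) (k : 'I_n) (v : 'rV[int]_n) : int := (v *m M) 0 k.

Lemma row_form_zmod_morphism n (M : 'M[int]_n) (k : 'I_n) : zmod_morphism (row_form M k).
Proof. by move=> u v; rewrite /row_form mulmxBl !mxE. Qed.

HB.instance Definition _ n (M : 'M[int]_n) (k : 'I_n) :=
  GRing.isZmodMorphism.Build _ _ (row_form M k) (row_form_zmod_morphism M k).

Lemma family_span_annihilated (F : fieldType) (T : finType) n (w : T -> 'rV[F]_n) (X : {set T})
    (C : 'cV[F]_n) (v : 'rV[F]_n) :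
  (forall x, x \in X -> w x *m C = 0) -> (v <= family_span w X)%MS -> v *m C = 0.
Proof.
move=> h vX; apply/sub_kermxP; apply: submx_trans vX _; apply/family_spanP => x xX.
by apply/sub_kermxP; apply: h.
Qed.

Lemma clear_denominators n (x : 'rV[rat]_n) :
  exists2 N : int, N != 0 & exists y : 'rV[int]_n, N%:~R *: x = ratv y.
Proof.
exists (\prod_i denq (x 0 i)); first by apply/prodf_neq0 => i _; apply: denq_neq0.
exists (\row_i (numq (x 0 i) * \prod_(j | j != i) denq (x 0 j))).
apply/rowP => i; rewrite !mxE (bigD1 i) //= !rmorphM /= mulrAC; congr (_ * _).
by rewrite numqE mulrC.
Qed.

Lemma det_rows_neq0 n (a : 'I_n -> 'rV[int]_n) :
  row_full (family_span (fun i => ratv (a i)) [set: 'I_n]) ->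
  \det (\matrix_(i, j) a i 0 j) != 0.
Proof.
set A := \matrix_(i, j) _ => fa; have : row_full (ratv A).
  apply: row_fullS fa _; apply/family_spanP => i _.
  have -> : a i = row i A by apply/rowP => j; rewrite !mxE.
  by rewrite map_row row_sub.
by rewrite row_full_unit unitmxE det_map_mx unitfE intr_eq0.
Qed.

(** Minkowski's second theorem on [L_I]: the forms are the [a]-coordinates with index in [J], scaled
    by [\det A], and the pigeonhole bound is applied to the points of [L_I] in ever larger boxes. *)
Lemma sublattice_basis_bound n (V : 'M[int]_n) (D : nat) (I J : {set 'I_n})
    (a : 'I_n -> 'rV[int]_n) (l : nat -> nat) :
  (0 < D)%N -> #|J| = #|I| -> {homo l : i j / (i <= j)%N} ->
  row_full (family_span (fun i => ratv (a i)) [set: 'I_n]) ->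
  (forall v (k : 'I_n), v \in sublattice V D [set: 'I_n] -> (supnorm v < l k)%N ->
     (ratv v <= family_span (fun i => ratv (a i)) [set i : 'I_n | (i < k)%N])%MS) ->
  row_full (family_span (fun i => delta_mx 0 i : 'rV[rat]_n) I +
            family_span (fun i => ratv (a i)) (~: J))%MS ->
  (#|lattice_box V D I D| * \prod_(k in J) l k <= D ^ #|I|)%N.
Proof.
move=> D0 cJ mono fa mina; set X := family_span _ I; set Y := family_span _ (~: J) => fXY.
pose A : 'M[int]_n := \matrix_(i, j) a i 0 j.
have rowA i : row i A = a i by apply/rowP => j; rewrite !mxE.
have dA : \det A != 0 by apply: det_rows_neq0.
pose alpha := row_form (\adj A).
have formA k j : alpha j (a k) = \det A *+ (k == j).
  by rewrite /alpha /row_form -rowA -row_mul mul_mx_adj !mxE.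
have alphaZ j c v : alpha j (c *: v) = c * alpha j v.
  exact: (raddf_intZ (row_form (\adj A) j)).
pose C j := col j (ratv (\adj A)).
have formC v j : ratv v *m C j = (alpha j v)%:~R%:M.
  rewrite /C -map_col -map_mxM; apply/matrixP => i i'; rewrite !ord1 !mxE mulr1n.
  by rewrite /alpha /row_form mxE; congr (_%:~R); apply: eq_bigr => k _; rewrite !mxE.
have form0 v j : ratv v *m C j = 0 -> alpha j v = 0.
  by rewrite formC => /matrixP/(_ 0 0); rewrite !mxE mulr1n => /eqP; rewrite intr_eq0 => /eqP.
have span0 (K : {set 'I_n}) (j : 'I_n) (v : 'rV[rat]_n) : j \notin K ->
    (v <= family_span (fun i => ratv (a i)) K)%MS -> v *m C j = 0.
  move=> jK; apply: family_span_annihilated => k kK; rewrite formC formA.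
  by rewrite (negPf (memPn jK _ kK)) // raddf0.
have suppX (v : 'rV[rat]_n) i : (v <= X)%MS -> i \notin I -> v 0 i = 0.
  move=> vX iI; have : v *m delta_mx i 0 = 0 :> 'M[rat]_1.
    apply: family_span_annihilated vX => k kI.
    by rewrite mul_delta_mx_0 // (memPn iI).
  by rewrite -colE => /matrixP/(_ 0 0); rewrite !mxE.
have inX v : v \in sublattice V D I -> (ratv v <= X)%MS.
  move=> /sublatticeP [_ v0]; rewrite (row_sum_delta (ratv v)) summx_sub // => i _.
  have [iI|iI] := boolP (i \in I); last by rewrite mxE v0 // scale0r sub0mx.
  by rewrite scalemx_sub // (@mem_family_span _ _ _ (fun i => delta_mx 0 i)).
(* The dimensions of [X] and [Y] are at most [#|I|] and [n - #|I|], while their sum is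
   everything. *)
have capXY : (X :&: Y)%MS = 0.
  apply/eqP; rewrite -mxrank_eq0.
  have aux (r1 r2 r3 i j : nat) : (r1 <= i -> r2 <= j -> n + r3 = r1 + r2 -> i + j = n -> r3 == 0)%N.
    lia.
  have rX := rank_family_span (fun i => delta_mx 0 i : 'rV[rat]_n) I.
  have rY := rank_family_span (fun i => ratv (a i)) (~: J).
  apply: (aux _ _ _ _ _ rX rY); last by rewrite -cJ cardsC card_ord.
  by rewrite -(mxrank_sum_cap X Y); move: fXY; rewrite /row_full => /eqP ->.
have inj v : v \in sublattice V D I -> (forall k, k \in J -> alpha k v = 0) -> v = 0.
  move=> Lv v0.
  have vA : \det A *: v = \sum_k alpha k v *: a k.
    rewrite -[v in LHS]mulmx1 scalemxAr scalemx1 -mul_adj_mx mulmxA mulmx_sum_row.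
    by apply: eq_bigr => k _; rewrite rowA.
  have vY : (ratv v <= Y)%MS.
    have -> : ratv v = ((\det A)%:~R)^-1 *: ratv (\det A *: v).
      by rewrite map_mxZ scalerA mulVf ?scale1r // intr_eq0.
    rewrite vA.
    rewrite scalemx_sub // map_mx_sum summx_sub // => k _; rewrite map_mxZ.
    have [kJ|kJ] := boolP (k \in J); first by rewrite v0 // scale0r sub0mx.
    by rewrite scalemx_sub // (@mem_family_span _ _ _ (fun i => ratv (a i))) // inE.
  have : (ratv v <= X :&: Y)%MS by rewrite sub_capmx inX.
  rewrite capXY submx0 => /eqP /rowP v00; apply/rowP => i; have := v00 i; rewrite !mxE.
  by move/eqP; rewrite intr_eq0 => /eqP.
(* Project [a k] to [X] along [Y], which the forms in [J] do not notice, then clear denominators and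
   multiply by [D] to land in [L_I]. *)
have nondeg k : k \in J -> exists2 v, v \in sublattice V D I &
    alpha k v != 0 /\ forall j, j \in J -> (k < j)%N -> alpha j v = 0.
  move=> kJ; have /sub_addsmxP [[u1 u2] /= uE] := submx_full (ratv (a k)) fXY.
  have [N N0 [y yE]] := clear_denominators (u1 *m X).
  have formy j : j \in J -> alpha j y = N * \det A *+ (k == j).
    move=> jJ; apply/eqP; rewrite -(@eqr_int rat); apply/eqP.
    have : ratv y *m C j = (N%:~R * (\det A *+ (k == j))%:~R)%:M.
      rewrite -yE -scalemxAl (_ : u1 *m X = ratv (a k) - u2 *m Y); last by rewrite uE addrK.
      rewrite mulmxBl formC formA (span0 (~: J) j (u2 *m Y)) ?submxMl ?inE ?jJ //.
      by rewrite subr0 scale_scalar_mx.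
    rewrite formC => /matrixP/(_ 0 0); rewrite !mxE !mulr1n => ->.
    by rewrite -intrM mulrnAr.
  have y0 i : i \notin I -> y 0 i = 0.
    move=> iI; have := congr1 (fun M : 'rV[rat]_n => M 0 i) yE.
    rewrite mxE (suppX _ i (submxMl _ _) iI) mulr0 mxE => /esym/eqP.
    by rewrite intr_eq0 => /eqP.
  exists (D%:Z *: y); first exact: scaled_in_sublattice.
  rewrite alphaZ formy // eqxx mulr1n; split.
    by rewrite !mulf_neq0 // eqz_nat -lt0n.
  move=> j jJ kj; rewrite alphaZ formy //.
  by have -> : (k == j) = false; [apply/eqP => e; move: kj; rewrite e ltnn|rewrite mulr0n mulr0].
(* A vector shorter than [l k] lies in the span of the [a i] with [i < k], where [alpha k]
   vanishes. *)
have minL v k : v \in sublattice V D I -> k \in J -> (supnorm v < l k)%N -> alpha k v = 0.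
  move=> /sublatticeP [v1 _] _ vl; apply: form0.
  apply: (span0 [set i : 'I_n | (i < k)%N]); first by rewrite inE ltnn.
  by apply: mina => //; apply/sublatticeP; split=> // i; rewrite inE.
have [s hs] := @lattice_pigeonhole n (sublattice V D I) J (fun k => row_form (\adj A) k)
  l mono inj nondeg minL.
(* Points of [[0, qD)^I] differ by at most [T = qD - 1] in norm, so [N = qD + s] is admissible. *)
apply: (@leq_exp_of_growth _ _ s) => q q0.
rewrite mulnAC -card_lattice_box // -cJ cardE.
rewrite -(size_map (@box_vector n (q * D))); apply: (hs _ (q * D).-1).
- by rewrite map_inj_uniq ?enum_uniq //; apply: box_vector_inj.
- by move=> x /mapP [f]; rewrite mem_enum inE => fL ->.
- move=> x y /mapP [f _ ->] /mapP [g _ ->]; apply/supnormP => i; rewrite !mxE.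
  have aux (c d m : nat) : (c < m -> d < m -> `|Posz c - Posz d| <= m.-1)%N by lia.
  exact: aux (ltn_ord _) (ltn_ord _).
have : (0 < q * D)%N by rewrite muln_gt0 q0.
by lia.
Qed.

(** * Matching coordinate sets with sets of minima *)

(** Basis exchange between the unit vectors and the [a j], with nothing fixed at the start. Indexing
    by a disjoint sum keeps the two families apart even where vectors coincide. *)
Lemma coordinate_matching (F : fieldType) n (a : 'I_n -> 'rV[F]_n) :
  row_full (family_span a [set: 'I_n]) ->
  exists2 f : {set 'I_n} -> {set 'I_n}, injective f & forall I : {set 'I_n}, #|f I| = #|I| /\
    row_full (family_span (fun i => delta_mx 0 i : 'rV[F]_n) I + family_span a (~: f I))%MS.
Proof.
move=> fa; pose w (x : 'I_n + 'I_n) : 'rV[F]_n :=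
  match x with inl i => delta_mx 0 i | inr j => a j end.
pose E : {set 'I_n + 'I_n} := [set inl i | i : 'I_n].
pose A : {set 'I_n + 'I_n} := [set inr i | i : 'I_n].
have inlI : injective (@inl 'I_n 'I_n) by move=> ? ? [].
have inrI : injective (@inr 'I_n 'I_n) by move=> ? ? [].
have [||||| g ginj gP] := @basis_exchange_matching F ('I_n + 'I_n)%type n w n finset.set0 E A.
- by rewrite card_imset // card_ord.
- by rewrite card_imset // card_ord.
- by rewrite cards0.
- rewrite -sub1mx; apply/row_subP => i; rewrite rowE mulmx1.
  by apply: (@mem_family_span _ _ _ w _ (inl i)); rewrite finset.set0U imset_f.
- apply: row_fullS fa _; apply/family_spanP => i _.
  by apply: (@mem_family_span _ _ _ w _ (inr i)); rewrite finset.set0U imset_f.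
have lE (I : {set 'I_n}) : [set inl i | i in I] \subset E.
  by apply/fintype.subsetP => _ /imsetP [i _ ->]; rewrite imset_f.
pose f (I : {set 'I_n}) := [set j : 'I_n | inr j \in g [set inl i | i in I]].
have gE (I : {set 'I_n}) : g [set inl i | i in I] = [set inr j | j in f I].
  have [gA _ _] := gP _ (lE I); apply/setP => x; apply/idP/imsetP => [xg|[j]].
    have /imsetP [j _ xE] := fintype.subsetP gA x xg.
    by exists j => //; rewrite inE -xE.
  by rewrite inE => jg ->.
exists f => [I I' fI|I].
  by apply: (imset_inj inlI); apply: ginj; rewrite ?powersetE // !gE fI.
have [_ gc gf] := gP _ (lE I); split.
  by rewrite -(card_imset _ inrI) -gE gc card_imset.
apply: row_fullS gf _; apply/family_spanP => x; rewrite !inE /= => /orP [/imsetP [i iI ->]|].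
  by apply: submx_trans (addsmxSl _ _); apply: (@mem_family_span _ _ _ (fun i => delta_mx 0 i)).
move=> /andP [xg /imsetP [j _ xE]]; apply: submx_trans (addsmxSr _ _).
by rewrite xE; apply: (@mem_family_span _ _ _ a _ j); rewrite !inE -xE.
Qed.

(** * Counting lattice points in dilates *)

(** Points are sorted by the set [I] of coordinates below [qD]. The other coordinates equal [qD], a
    multiple of [D], and subtracting them leaves a point of [L_I] in the half-open box. *)
Lemma card_closed_box n (V : 'M[int]_n) (D q : nat) : (0 < D)%N -> (0 < q)%N ->
  #|[set f : {ffun 'I_n -> 'I_(q * D).+1} | box_vector f \in sublattice V D [set: 'I_n]]| =
  (\sum_(I : {set 'I_n}) #|lattice_box V D I D| * q ^ #|I|)%N.
Proof.
move=> D0 q0; pose T := (q * D)%N; rewrite -/T.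
have T0 : (0 < T)%N by rewrite muln_gt0 q0.
pose supp (f : {ffun 'I_n -> 'I_T.+1}) : {set 'I_n} := [set i | (f i < T)%N].
rewrite -sum1_card (partition_big supp xpredT) //=; apply: eq_bigr => I _.
rewrite -card_lattice_box // -/T sum1_card.
have lT : (T <= T.+1)%N by [].
pose h (b : {ffun 'I_n -> 'I_T}) : {ffun 'I_n -> 'I_T.+1} :=
  [ffun i => if i \in I then widen_ord lT (b i) else ord_max].
pose c : 'rV[int]_n := \row_i (if i \in I then 0 else q%:Z).
have hE b : box_vector b \in sublattice V D I -> box_vector (h b) = box_vector b + D%:Z *: c.
  move=> /sublatticeP [_ b0]; apply/rowP => i; rewrite !mxE ffunE.
  case: ifPn => iI; first by rewrite mulr0 addr0.
  by have := b0 i iI; rewrite mxE => ->; rewrite add0r -PoszM mulnC.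
have cS : D%:Z *: c \in sublattice V D [set: 'I_n].
  by apply: scaled_in_sublattice => i; rewrite inE.
have subI t : t \in sublattice V D I -> t \in sublattice V D [set: 'I_n].
  by move=> /sublatticeP [t1 _]; apply/sublatticeP; split=> // i; rewrite inE.
have hinj : {in lattice_box V D I T &, injective h}.
  move=> b b' bL b'L e; apply: (@box_vector_inj n T); apply: (addIr (D%:Z *: c)).
  by rewrite -!hE ?e //; [move: b'L|move: bL]; rewrite inE.
rewrite -(card_in_imset hinj); apply: eq_card => f; rewrite [LHS]unfold_in /= inE.
apply/andP/imsetP => [[Lf /eqP sf]|[b]].
  (* Reduction modulo [T] keeps the coordinates in [I] and turns those equal to [T] into 0. *)
  have fb i : (f i %% T < T)%N by rewrite ltn_mod.
  pose b : {ffun 'I_n -> 'I_T} := [ffun i => Ordinal (fb i)].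
  have inI i : (i \in I) = (f i < T)%N by rewrite -sf inE.
  have fT i : i \notin I -> f i = T :> nat.
    by rewrite inI -leqNgt => h1; apply/eqP; rewrite eqn_leq h1 -ltnS ltn_ord.
  have fE : f = h b.
    apply/ffunP => i; apply: val_inj; rewrite !ffunE; case: ifPn => iI /=; last by rewrite fT.
    by rewrite modn_small // -inI.
  have bE : box_vector b = box_vector f - D%:Z *: c.
    apply/rowP => i; rewrite !mxE ffunE /=; case: ifPn => iI.
      by rewrite modn_small -?inI // mulr0 subr0.
    by rewrite fT // modnn -PoszM mulnC subrr.
  exists b => //; rewrite inE; apply/sublatticeP; split.
    by have /sublatticeP [] : box_vector b \in sublattice V D [set: 'I_n] by rewrite bE rpredB.
  by move=> i iI; rewrite mxE ffunE /= fT // modnn.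
rewrite inE => bL ->; split; first by rewrite hE // rpredD // subI.
apply/eqP/setP => i; rewrite inE ffunE; case: ifPn => iI /=; first by rewrite ltn_ord.
by rewrite ltnn.
Qed.

Lemma polyfun_coef_unique (R : realType) n (g c : nat -> R) :
  (forall k, (0 < k)%N -> \sum_(i < n.+1) g i * k%:R ^+ i = \sum_(i < n.+1) c i * k%:R ^+ i) ->
  forall i, (i <= n)%N -> g i = c i.
Proof.
move=> h i ni; pose P := \poly_(i < n.+1) (g i - c i).
have P0 : P = 0.
  (* The difference has degree at most [n] and the [n + 1] roots [1, ..., n + 1]. *)
  apply: (@roots_geq_poly_eq0 _ _ [seq k%:R | k <- iota 1 n.+1]).
  - apply/allP => x /mapP [k]; rewrite mem_iota => /andP [k0 _] ->.
    rewrite /root horner_poly; under eq_bigr do rewrite mulrBl.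
    by rewrite sumrB h // subrr.
  - by rewrite map_inj_uniq ?iota_uniq // => x y /eqP; rewrite eqr_nat => /eqP.
  by rewrite size_map size_iota size_poly.
have := congr1 (fun Q : {poly R} => Q`_i) P0.
by rewrite coef0 coef_poly ltnS ni => /eqP; rewrite subr_eq0 => /eqP.
Qed.

(** * Real lattice points, parallelepipeds and difference bodies *)

Local Open Scope classical_set_scope.
Local Open Scope ring_scope.

Notation intmx R := (map_mx (intr : int -> R)).

Lemma latticeP (R : realType) n (x : 'rV[R]_n) :
  lattice x <-> exists y : 'rV[int]_n, x = intmx R y.
Proof.
split=> [lx|[y ->] j]; last by rewrite mxE intr_int.
exists (\row_j Num.floor (x 0 j)); apply/rowP => j; rewrite !mxE floorK //; exact: lx.
Qed.

Lemma full_dim_det_neq0 (R : realType) n (p : 'rV[R]_n) (V : 'M[int]_n) :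
  full_dim (parallelepiped p (fun i => row i (intmx R V))) -> \det V != 0.
Proof.
move=> [m [a [b [ab rk]]]].
have sub : ((\matrix_(i < m) (a i - b i)) <= intmx R V)%MS.
  apply/row_subP => i; rewrite rowK; have [[s [_ ->]] [t [_ ->]]] := ab i.
  rewrite opprD addrACA subrr add0r -sumrB summx_sub // => j _.
  by rewrite -scalerBl scalemx_sub // row_sub.
have : row_full (intmx R V).
  by rewrite /row_full eqn_leq rank_leq_col (leq_trans rk) // mxrankS.
by rewrite row_full_unit unitmxE det_map_mx unitfE intr_eq0.
Qed.

Lemma lattice_coordinates (R : realType) n (V : 'M[int]_n) (x : 'rV[R]_n) : \det V != 0 ->
  lattice (x *m intmx R V) <->
  exists2 t, t \in sublattice V `|\det V| [set: 'I_n] & x = (`|\det V|%N%:R)^-1 *: intmx R t.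
Proof.
move=> dV; set D := `|\det V|%N.
have DE : D%:Z = sgz (\det V) * \det V by rewrite /D abszEsg.
have D0 : D%:R != 0 :> R by rewrite pnatr_eq0 absz_eq0.
split=> [/latticeP [y yE]|[t /sublatticeP [tV _] ->]]; last first.
  rewrite -scalemxAl -map_mxM => j; rewrite !mxE.
  have := tV j; rewrite mxE => /dvdzP [c ->].
  by rewrite rmorphM /= -pmulrn mulrCA mulVf // mulr1 intr_int.
(* Cramer's rule; the sign of the determinant is absorbed so that [t] is [D] times [x] with [D]
   positive. *)
pose t : 'rV[int]_n := sgz (\det V) *: (y *m \adj V).
have tE : intmx R t = D%:R *: x.
  rewrite map_mxZ map_mxM -yE -mulmxA -map_mxM mul_mx_adj map_scalar_mx.
  rewrite mul_mx_scalar scalerA -intrM -DE //.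
exists t; last by rewrite tE scalerA mulVf // scale1r.
apply/sublatticeP; split=> [j|i]; last by rewrite inE.
rewrite -scalemxAl -mulmxA mul_adj_mx mul_mx_scalar scalerA -DE mxE.
exact: dvdz_mulr.
Qed.

(** The dilate is a translate by the lattice point [q p] of the closed box [[0, qD]^n] in edge
    coordinates, so the count of that box applies. *)
Lemma npoints_parallelepiped (R : realType) n (p : 'rV[R]_n) (V : 'M[int]_n) (q : nat) :
  lattice p -> \det V != 0 -> (0 < q)%N ->
  npoints (dilate q%:R (parallelepiped p (fun i => row i (intmx R V)))) =
  (\sum_(I : {set 'I_n}) #|lattice_box V `|\det V| I `|\det V| | * q ^ #|I|)%N.
Proof.
move=> /latticeP [p0 pE] dV q0; set D := `|\det V|%N.
have D0 : (0 < D)%N by rewrite absz_gt0.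
have D0R : 0 < D%:R :> R by rewrite ltr0n.
have q0R : 0 < q%:R :> R by rewrite ltr0n.
rewrite -card_closed_box //; set A := [set f | _]%SET.
pose phi (f : {ffun 'I_n -> 'I_(q * D).+1}) : 'rV[R]_n :=
  q%:R *: p + D%:R^-1 *: intmx R (box_vector f) *m intmx R V.
have Vu : intmx R V \in unitmx by rewrite unitmxE det_map_mx unitfE intr_eq0.
have phi_inj : injective phi.
  move=> f g /addrI /(can_inj (mulmxK Vu)) /(scalerI _) e.
  apply: box_vector_inj; apply/rowP => i.
  have /rowP/(_ i) := e (invr_neq0 (lt0r_neq0 D0R)); rewrite !mxE => /eqP.
  by rewrite eqr_int => /eqP.
have imE : dilate q%:R (parallelepiped p (fun i => row i (intmx R V))) `&` @lattice R n =
    [set` [fset phi f | f in A]%fset].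
  apply/seteqP; split=> x /=.
    move=> [[y [t [t01 ->]]] <- lx].
    have lx' : lattice (q%:R *: (\row_i t i) *m intmx R V).
      have -> : q%:R *: (\row_i t i) *m intmx R V =
          q%:R *: (p + \sum_(i < n) t i *: row i (intmx R V)) - q%:R *: p.
        rewrite -scalerBr [p + _]addrC addrK -scalemxAl mulmx_sum_row; congr (_ *: _).
        by apply: eq_bigr => i _; rewrite mxE.
      move=> j; rewrite mxE rpredD //.
      by rewrite pE !mxE rpredN rpredM ?natr_int ?intr_int.
    have [s sL sE] := (lattice_coordinates _ dV).1 lx'.
    have sE' i : (s 0 i)%:~R = (q * D)%:R * t i :> R.
      have /rowP/(_ i) := sE; rewrite !mxE => e.
      by rewrite natrM mulrAC e mulrC mulrA mulfV ?mul1r // lt0r_neq0.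
    have sb i : (0 <= s 0 i <= (q * D)%:Z).
      have /andP [t0 t1] := t01 i.
      rewrite -!(ler_int R) sE' mulr_ge0 //=.
      by rewrite -[X in _ <= X]mulr1 ler_wpM2l.
    have sb' i : (`|s 0%R i| < (q * D).+1)%N by have := sb i; lia.
    pose f : {ffun 'I_n -> 'I_(q * D).+1} := [ffun i => Ordinal (sb' i)].
    have fE : box_vector f = s.
      apply/rowP => i; rewrite !mxE ffunE /=; apply: gez0_abs.
      by have /andP [] := sb i.
    apply/imfsetP; exists f => /=; first by rewrite inE fE.
    rewrite /phi fE -sE -scalemxAl mulmx_sum_row -scalerDr; congr (_ *: (_ + _)).
    by apply: eq_bigr => i _; rewrite mxE.
  move=> /imfsetP [f /= Lf0 ->].
  have Lf : box_vector f \in sublattice V D [set: 'I_n] by move: Lf0; rewrite inE.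
  have lV := (lattice_coordinates _ dV).2 (ex_intro2 _ _ (box_vector f) Lf erefl).
  have lphi : lattice (phi f).
    move=> j; rewrite mxE rpredD //; last exact: lV.
    by rewrite pE !mxE rpredM ?natr_int ?intr_int.
  suff dphi : dilate q%:R (parallelepiped p (fun i => row i (intmx R V))) (phi f).
    exact: conj dphi lphi.
  exists (p + \sum_(i < n) ((f i)%:R / (q * D)%:R) *: row i (intmx R V)).
    exists (fun i => (f i)%:R / (q * D)%:R); split=> // i.
    rewrite divr_ge0 //= ler_pdivrMr ?ltr0n ?muln_gt0 ?q0 // mul1r ler_nat.
    by rewrite -ltnS ltn_ord.
  rewrite scalerDr /phi; congr (_ + _); rewrite mulmx_sum_row scaler_sumr.
  apply: eq_bigr => i _; rewrite scalerA !mxE; congr (_ *: _).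
  rewrite natrM -pmulrn; field.
  by rewrite !pnatr_eq0 -!lt0n D0 q0.
by rewrite /npoints imE set_fsetK card_imfset //= -cardE.
Qed.

Lemma diffbody_parallelepiped (R : realType) n (p : 'rV[R]_n) (v : 'I_n -> 'rV[R]_n) z :
  diffbody (parallelepiped p v) z <->
  exists s : 'I_n -> R, (forall i, `|s i| <= 1) /\ z = \sum_i s i *: v i.
Proof.
split=> [[_ [_ [[s [s01 ->]] [[t [t01 ->]] ->]]]]|[s [s1 ->]]].
  exists (fun i => s i - t i); split=> [i|]; last first.
    by rewrite opprD addrACA subrr add0r -sumrB; apply: eq_bigr => i _; rewrite scalerBl.
  by have /andP [? ?] := s01 i; have /andP [? ?] := t01 i; rewrite ler_norml; lra.
(* The two points lie symmetrically about the centre of the parallelepiped. *)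
exists (p + \sum_i ((1 + s i) / 2) *: v i), (p + \sum_i ((1 - s i) / 2) *: v i).
split; last split.
- exists (fun i => (1 + s i) / 2); split=> // i.
  by have := s1 i; rewrite ler_norml => /andP [? ?]; lra.
- exists (fun i => (1 - s i) / 2); split=> // i.
  by have := s1 i; rewrite ler_norml => /andP [? ?]; lra.
rewrite opprD addrACA subrr add0r -sumrB; apply: eq_bigr => i _; rewrite -scalerBl.
by congr (_ *: _); field.
Qed.

(** A nonzero lattice point has an edge coordinate that is a nonzero multiple of [1 / D], while all
    its edge coordinates are bounded by [r]. This keeps the successive minima away from 0. *)
Lemma dilated_diffbody_norm (R : realType) n (p : 'rV[R]_n) (V : 'M[int]_n) (r : R)
    (x : 'rV[R]_n) :
  \det V != 0 -> 0 < r -> x != 0 -> lattice x ->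
  dilate r (diffbody (parallelepiped p (fun i => row i (intmx R V)))) x ->
  (`|\det V|%N%:R)^-1 <= r.
Proof.
move=> dV r0 x0 lx [z /diffbody_parallelepiped [s [s1 zE]] xE].
have xV : x = (r *: \row_i s i) *m intmx R V.
  rewrite -xE zE -scalemxAl mulmx_sum_row; congr (_ *: _).
  by apply: eq_bigr => i _; rewrite mxE.
have D0 : 0 < (`|\det V|%N)%:R :> R by rewrite ltr0n absz_gt0.
move: lx x0; rewrite xV => /(lattice_coordinates _ dV) [t _ tE] x0.
have [k tk] : exists k, t 0 k != 0.
  apply: contrapT => h; case/negP: x0; rewrite tE (_ : t = 0) ?raddf0 ?scaler0 ?mul0mx //.
  by apply/rowP => k; rewrite mxE; apply/eqP; apply: contrapT => /negP tk; apply: h; exists k.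
have /rowP/(_ k) := tE; rewrite !mxE => sE.
have le1 : 1 <= `|(t 0 k)%:~R| :> R by rewrite -intr_norm ler1z; lia.
have : `|(`|\det V|%N)%:R^-1 * (t 0 k)%:~R| <= r.
  rewrite -sE normrM (gtr0_norm r0) -[X in _ <= X]mulr1.
  by rewrite ler_wpM2l // ltW.
rewrite normrM gtr0_norm ?invr_gt0 //; apply: le_trans.
by rewrite -[X in X <= _]mulr1 ler_wpM2l // invr_ge0 ltW.
Qed.

(** The minima enter [sigma] through their inverses, so a lower bound for [sigma] calls for upper
    bounds on positive minima. The dilate by [l j / D] contains 0 and the independent points given
    by the [a i] with [i <= j]. *)
Lemma succmin_bounds (R : realType) n (p : 'rV[R]_n) (V : 'M[int]_n)
    (a : 'I_n -> 'rV[int]_n) (l : nat -> nat) (j : 'I_n) :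
  \det V != 0 -> {homo l : i j / (i <= j)%N} ->
  (forall j : 'I_n, [/\ a j \in sublattice V `|\det V| [set: 'I_n]%SET, supnorm (a j) = l j
     & (0 < l j)%N]) ->
  row_full (family_span (fun i => ratv (a i)) [set: 'I_n]%SET) ->
  0 < succmin (diffbody (parallelepiped p (fun i => row i (intmx R V)))) j.+1
    <= (l j)%:R / (`|\det V|%N)%:R.
Proof.
move=> dV mono aP fa; set K := diffbody _; set D := `|\det V|%N.
have D0 : 0 < D%:R :> R by rewrite ltr0n absz_gt0.
rewrite /succmin; set S := [set r : R | _].
have lbS : lbound S D%:R^-1.
  move=> r [r0 [m [b [c [bc rk]]]]].
  (* Positive rank yields two distinct points, at least one of which is nonzero. *)
  have [i bci] : exists i, b i - c i != 0.
    apply: contrapT => h; move: rk; rewrite (_ : \matrix_i _ = 0) ?mxrank0 //.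
    apply/row_matrixP => i; rewrite rowK row0; apply/eqP; apply: contrapT => /negP bci.
    by apply: h; exists i.
  have [[bK bl] [cK cl]] := bc i.
  have [b0|b0] := eqVneq (b i) 0; last exact: dilated_diffbody_norm dV r0 b0 bl bK.
  have c0 : c i != 0 by apply: contra bci => /eqP ->; rewrite b0 subrr.
  exact: dilated_diffbody_norm dV r0 c0 cl cK.
have lj0 : 0 < (l j)%:R :> R by rewrite ltr0n; have [] := aP j.
have Sl : S ((l j)%:R / D%:R).
  split; first by rewrite divr_gt0.
  have jn := ltn_ord j; pose w (i : 'I_j.+1) := widen_ord jn i.
  exists j.+1, (fun i => (D%:R^-1 *: intmx R (a (w i))) *m intmx R V), (fun=> 0); split=> [i|].
    split; last first.
      split; last by move=> k; rewrite mxE rpred0.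
      exists 0; last by rewrite scaler0.
      apply/diffbody_parallelepiped; exists (fun=> 0); split=> [k|]; first by rewrite normr0.
      by rewrite big1 // => k _; rewrite scale0r.
    have [aL al _] := aP (w i); split; last by apply/(lattice_coordinates _ dV); exists (a (w i)).
    exists (\sum_k ((a (w i) 0 k)%:~R / (l j)%:R) *: row k (intmx R V)).
      apply/diffbody_parallelepiped; exists (fun k => (a (w i) 0 k)%:~R / (l j)%:R); split=> // k.
      rewrite normrM normfV (gtr0_norm lj0) ler_pdivrMr // mul1r -intr_norm -abszE.
      rewrite -pmulrn ler_nat; apply: leq_trans (leq_supnorm _ _) _; rewrite al.
      by apply: mono; rewrite -ltnS /=.
    rewrite mulmx_sum_row scaler_sumr; apply: eq_bigr => k _; rewrite scalerA !mxE.
    by congr (_ *: _); field; rewrite !lt0r_neq0.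
  pose A : 'M[int]_n := \matrix_(i, k) a i 0 k.
  have dA : \det A != 0 by apply: det_rows_neq0.
  pose M := D%:R^-1 *: intmx R A *m intmx R V.
  have Mu : row_free M.
    rewrite row_free_unit unitmx_mul; apply/andP; split.
      rewrite unitmxZ ?unitfE ?invr_eq0 ?lt0r_neq0 //.
      by rewrite unitmxE det_map_mx unitfE intr_eq0.
    by rewrite unitmxE det_map_mx unitfE intr_eq0.
  (* These are the first [j + 1] rows of the invertible matrix [M]. *)
  have -> : \matrix_(i < j.+1) ((D%:R^-1 *: intmx R (a (w i))) *m intmx R V - 0) =
      (pid_mx j.+1 : 'M_(j.+1, n)) *m M.
    apply/row_matrixP => i; rewrite rowK subr0 row_mul.
    have -> : row i (pid_mx j.+1 : 'M[R]_(j.+1, n)) = delta_mx 0 (w i).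
      by apply/rowP => k; rewrite !mxE ltn_ord andbT eqxx /= eq_sym -val_eqE /= eq_sym.
    rewrite -rowE row_mul; congr (_ *m _); apply/rowP => k; by rewrite !mxE.
  by rewrite mxrankMfree // rank_pid_mx.
apply/andP; split.
  apply: (@lt_le_trans _ _ D%:R^-1); first by rewrite invr_gt0.
  by apply: lb_le_inf => //; exists ((l j)%:R / D%:R).
by apply: ge_inf => //; exists D%:R^-1.
Qed.

Lemma ehrhart_coefficient (R : realType) n (p : 'rV[R]_n) (V : 'M[int]_n) (g : nat -> R) :
  lattice p -> \det V != 0 ->
  (forall k : nat,
     (npoints (dilate k%:R (parallelepiped p (fun i => row i (intmx R V)))))%:R
       = \sum_(i < n.+1) g i * k%:R ^+ i) ->
  forall i : nat, (i <= n)%N ->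
  g i = \sum_(I : {set 'I_n} | #|I| == i) (#|lattice_box V `|\det V| I `|\det V| |)%:R.
Proof.
move=> lp dV h; apply: polyfun_coef_unique => k k0.
rewrite -h npoints_parallelepiped // natr_sum.
(* Grouping the sets [I] by cardinality turns the count into a polynomial in [k] whose coefficients
   can be compared. *)
rewrite (partition_big (fun I : {set 'I_n} => inord #|I| : 'I_n.+1) xpredT) //=.
apply: eq_bigr => i _; rewrite mulr_suml.
have cI (I : {set 'I_n}) : (#|I| < n.+1)%N by rewrite ltnS -[X in (_ <= X)%N]card_ord max_card.
apply: eq_big => I; first by rewrite -val_eqE /= inordK.
by move=> /eqP <-; rewrite inordK // natrM natrX.
Qed.

Theorem theorem1p4 (R : realType) (n : nat) (p : 'rV[R]_n) (v : 'I_n -> 'rV[R]_n)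
  (g : nat -> R) :
  lattice p -> (forall i, lattice (v i)) ->
  full_dim (parallelepiped p v) ->
  (forall k : nat,
     (npoints (dilate k%:R (parallelepiped p v)))%:R
       = \sum_(i < n.+1) g i * k%:R ^+ i) ->
  forall i : nat, (i <= n)%N -> g i <= sigma (parallelepiped p v) i.
Proof.
move=> lp lv; have /choice [y yE] : forall i, exists y : 'rV[int]_n, v i = intmx R y.
  by move=> i; apply/latticeP.
pose V : 'M[int]_n := \matrix_(i, j) y i 0 j.
have -> : v = fun i => row i (intmx R V).
  by apply/funext => i; rewrite yE; apply/rowP => j; rewrite !mxE.
move=> /full_dim_det_neq0 dV h i ni; rewrite (ehrhart_coefficient lp dV h ni).
set D := `|\det V|%N; have D0 : (0 < D)%N by rewrite absz_gt0.
have D0R : 0 < D%:R :> R by rewrite ltr0n.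
have hL k : D%:Z *: delta_mx 0 k \in sublattice V D [set: 'I_n]%SET.
  by apply: scaled_in_sublattice => j; rewrite inE.
have [a [l [mono aP fa mina]]] := successive_basis D0 hL.
have [f finj fP] := coordinate_matching fa.
(* Being an injection of a finite set into itself, [f] is a bijection; it preserves cardinality, so
   the two sums can be compared term by term. *)
rewrite /sigma [X in _ <= X](reindex f) /=; last exact/onW_bij/injF_bij.
rewrite [X in _ <= X](eq_bigl (fun I : {set 'I_n} => #|I| == i)); last first.
  by move=> I; have [-> _] := fP I.
apply: ler_sum => I _; have [cf ff] := fP I.
have := sublattice_basis_bound D0 cf mono fa mina ff.
rewrite -(ler_nat R) natrM natrX -cf -prodr_const natr_prod => bnd.
have l0 (j : 'I_n) : 0 < (l j)%:R :> R by rewrite ltr0n; have [] := aP j.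
apply: (@le_trans _ _ (\prod_(j in f I) (D%:R / (l j)%:R))).
  by rewrite prodf_div ler_pdivlMr // prodr_gt0.
apply: ler_prod => j _; rewrite divr_ge0 //=.
have /andP [s0 sl] := succmin_bounds p j dV mono aP fa.
by rewrite -[X in X <= _]invrK lef_pV2 ?posrE ?invr_gt0 ?divr_gt0 // invf_div.
Qed.
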